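(* Let $\mu$ be a probability measure on $\mathbb{R}$ and let $x^\ast\in(-\infty,+\infty]$ be the right endpoint of $\mathrm{supp}(\mu)$. Then \[ \lim_{x\to x^\ast}\frac{-\log\mu([x,\infty))}{\Lambda_\mu^\ast(x)}=1 \] if and only if there exist $a<x^\ast$ and a convex function $V:(a,x^\ast)\to\mathbb{R}$ such that $\lim_{x\to x^\ast}\frac{-\log\mu([x,\infty))}{V(x)}=1$.
   Context: For $X\sim\mu$: $\Lambda_\mu(t)=\log\mathbb{E}e^{tX}$ and $\Lambda_\mu^\ast(x)=\sup_{t\in\mathbb{R}}(tx-\Lambda_\mu(t))$ is the Cramér transform of $\mu$. Limits $x\to x^\ast$ are taken from the left. *)

(* Defs.v *)
From HB Require Import structures.
From mathcomp Require Import all_boot all_order all_algebra.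
From mathcomp Require Import all_classical all_reals all_analysis.
Set Implicit Arguments. Unset Strict Implicit. Unset Printing Implicit Defensive.
Import Order.TTheory GRing.Theory Num.Theory.
Import numFieldNormedType.Exports.
Local Open Scope classical_set_scope.
Local Open Scope ring_scope.

Section Cramer.
Variable R : realType.
Variable mu : probability R R.

Definition lmgf (t : R) : \bar R :=
  match (\int[mu]_x (expR (t * x))%:E)%E with
  | EFin r => EFin (ln r)
  | EPInf => +oo%E
  | ENInf => -oo%E
  end.

Definition cramer (x : R) : \bar R :=
  ereal_sup [set ((t * x)%:E - lmgf t)%E | t in [set: R]].

Definition msupport : set R :=
  [set x | forall U : set R, open U -> U x -> (0 < mu U)%E].

Definition right_endpoint : \bar R := ereal_sup [set x%:E | x in msupport].

Definition neglogtail (x : R) : R := - ln (fine (mu `[x, +oo[%classic)).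

End Cramer.

Definition lim_left (R : realType) (xs : \bar R) (f : R -> R) (l : R) : Prop :=
  match xs with
  | EFin r => f x @[x --> r^'-] --> l
  | EPInf => f x @[x --> +oo] --> l
  | ENInf => False
  end.

Definition convex_on (R : realType) (D : set R) (V : R -> R) : Prop :=
  forall x y t, D x -> D y -> 0 <= t <= 1 ->
    V (t * x + (1 - t) * y) <= t * V x + (1 - t) * V y.

(* Main.v *)
Require Import Defs.
From HB Require Import structures.
From mathcomp Require Import all_boot all_order all_algebra.
From mathcomp Require Import all_classical all_reals all_analysis.
From mathcomp Require Import measurable_realfun ring lra.
Import Order.TTheory GRing.Theory Num.Theory.
Import numFieldNormedType.Exports.
Local Open Scope classical_set_scope.
Local Open Scope ring_scope.

(** Write [N x = - ln mu [x, +oo[] and [L] for the Cramer transform. A limit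
    [N / L -> 1] forces [L] to be finite and nonzero near the right endpoint, and
    [L] is a supremum of affine functions, so [V = L] works.

    Conversely let [V] be convex with [N ~ V]. Markov's inequality gives [L <= N]
    near the endpoint, so it suffices to find, for every [eta < 1] and [x] close
    to the endpoint, some [t > 0] with [E e^(t (X - x)) <= e^(- eta N x)].
    - If the tail vanishes at the endpoint, take [t = q^2 s] with [q < 1] close to
      1 and [s] a subgradient of [V] at [x]. Where [q V <= N], the integrand is at
      most [e^(q N(X)) e^(- q^2 V x)], and [E e^(q N(X))] is finite because
      [P (N(X) >= k) <= e^(-k)]. The constant is absorbed since [N -> +oo].
    - Otherwise the endpoint [r] is finite and is an atom, and
      [E e^(t (X - r)) -> mu {r}] as [t -> +oo], so a large fixed [t] works. *)

(** * Left neighbourhoods of a possibly infinite endpoint *)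

(** One form for a finite endpoint and for [+oo], so that later arguments need not split. At [-oo]
    no [b] exists, in agreement with the value [False] of [lim_left]. *)
Definition eventually_left {R : realType} (xs : \bar R) (P : R -> Prop) :=
  exists2 b : R, (b%:E < xs)%E & forall x, b < x -> (x%:E < xs)%E -> P x.

Lemma eventually_leftI {R : realType} (xs : \bar R) (P Q : R -> Prop) :
  eventually_left xs P -> eventually_left xs Q ->
  eventually_left xs (fun x => P x /\ Q x).
Proof.
move=> [b bx hb] [c cx hc]; exists (Num.max b c).
  by case: (leP b c).
by move=> x; rewrite gt_max => /andP[bx' cx'] xx; split; [exact: hb|exact: hc].
Qed.

Lemma eventually_leftW {R : realType} (xs : \bar R) (P Q : R -> Prop) :
  (forall x, (x%:E < xs)%E -> P x -> Q x) ->
  eventually_left xs P -> eventually_left xs Q.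
Proof.
by move=> PQ [b bx hb]; exists b => // x bx' xx; apply: PQ => //; exact: hb.
Qed.

Lemma eventually_left_gt {R : realType} (xs : \bar R) (c : R) :
  (c%:E < xs)%E -> eventually_left xs (fun x => c < x).
Proof. by move=> cx; exists c. Qed.

Lemma lt_ereal_dense {R : realType} (xs : \bar R) (b : R) :
  (b%:E < xs)%E -> exists2 x, b < x & (x%:E < xs)%E.
Proof.
case: xs => [r| |] //=.
- rewrite lte_fin => br; exists ((b + r) / 2); last rewrite lte_fin; lra.
- by move=> _; exists (b + 1); rewrite ?ltry //; lra.
Qed.

Lemma eventually_left_ex {R : realType} (xs : \bar R) (P : R -> Prop) :
  eventually_left xs P -> exists2 x, (x%:E < xs)%E & P x.
Proof.
move=> [b /lt_ereal_dense[x bx xx] hb]; exists x => //; exact: hb.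
Qed.

Lemma lim_leftP {R : realType} (xs : \bar R) (f : R -> R) (l : R) :
  lim_left xs f l <->
  forall e : R, 0 < e -> eventually_left xs (fun x => `|f x - l| < e).
Proof.
case: xs => [r| |] /=.
- split.
  + move=> /cvgrPdist_lt h e /h; rewrite near_withinE.
    move=> /nbhs_ballP[d /= d0 hd].
    exists (r - d); first by rewrite lte_fin; lra.
    move=> x dx; rewrite lte_fin => xr; rewrite distrC; apply: hd => //=.
    by rewrite /ball /= ger0_norm; lra.
  + move=> h; apply/cvgrPdist_lt => e /h [b]; rewrite lte_fin => br hb.
    near=> x; rewrite distrC; apply: hb; last by rewrite lte_fin.
    by near: x; exact: nbhs_left_gt.
- split.
  + move=> /cvgrPdist_lt h e /h [M [_ hM]]; exists M; rewrite ?ltry //.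
    by move=> x Mx _; rewrite distrC; exact: hM.
  + move=> h; apply/cvgrPdist_lt => e /h [b _ hb].
    near=> x; rewrite distrC; apply: hb; rewrite ?ltry //.
    by near: x; apply: nbhs_pinfty_gt; rewrite num_real.
- by split => // /(_ 1 ltr01)[b].
Unshelve. all: by end_near. Qed.

(** * Convexity: subgradients and the Cramer transform *)

(** Chords to the left of [x] have slopes at most those of chords to its right, so the supremum of
    the left slopes is a subgradient. The points [y0] and [z0] make the set of left slopes nonempty
    and bounded above. *)
Lemma convex_on_subgradient {R : realType} (D : set R) (V : R -> R) (x y0 z0 : R) :
  convex_on D V -> D x -> D y0 -> D z0 -> y0 < x < z0 ->
  exists s, forall y, D y -> V x + s * (y - x) <= V y.
Proof.
move=> cV Dx Dy0 Dz0 /andP[yx xz].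
pose slope y := (V x - V y) / (x - y).
have slopes y z : D y -> D z -> y < x -> x < z -> slope y <= (V z - V x) / (z - x).
  move=> Dy Dz yx' xz'.
  have zy : 0 < z - y by lra.
  have := cV y z ((z - x) / (z - y)) Dy Dz.
  have -> : (z - x) / (z - y) * y + (1 - (z - x) / (z - y)) * z = x.
    by field; rewrite gt_eqF.
  have -> : 0 <= (z - x) / (z - y) <= 1.
    by apply/andP; split; [apply: divr_ge0|rewrite ler_pdivrMr // mul1r]; lra.
  move=> /(_ isT).
  have -> : 1 - (z - x) / (z - y) = (x - y) / (z - y) by field; rewrite gt_eqF.
  rewrite [leRHS](_ : _ = ((z - x) * V y + (x - y) * V z) / (z - y)); last first.
    by field; rewrite gt_eqF.
  rewrite ler_pdivlMr // => h.
  rewrite /slope ler_pdivrMr ?subr_gt0 // mulrAC ler_pdivlMr ?subr_gt0 //.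
  by nra.
pose S := [set slope y | y in [set y | D y /\ y < x]].
have supS : has_sup S.
  split; first by exists (slope y0), y0.
  exists ((V z0 - V x) / (z0 - x)) => _ [y [Dy yx'] <-].
  exact: slopes.
exists (sup S) => y Dy.
case: (ltgtP y x) => [yx'|xy|->]; last lra.
- have : slope y <= sup S by apply: ub_le_sup; [exact: supS.2|exists y].
  rewrite /slope ler_pdivrMr ?subr_gt0 //; nra.
- have : sup S <= (V y - V x) / (y - x).
    apply: ge_sup; first exact: supS.1.
    by move=> _ [u [Du ux] <-]; exact: slopes.
  rewrite ler_pdivlMr ?subr_gt0 //; nra.
Qed.

Lemma cramer_ge0 {R : realType} (mu : probability R R) (x : R) :
  (0 <= cramer mu x)%E.
Proof.
apply: ereal_sup_ubound; exists 0 => //.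
rewrite /lmgf mul0r; under eq_integral do rewrite mul0r expR0.
by rewrite integral_cst// [X in (_ * X)%E]probability_setT mule1/= ln1 sube0.
Qed.

Lemma cramer_convex {R : realType} (mu : probability R R) (D : set R) :
  (forall x, D x -> cramer mu x \is a fin_num) ->
  convex_on D (fun x => fine (cramer mu x)).
Proof.
move=> fD x y s Dx Dy /andP[s0 s1].
set z := s * x + (1 - s) * y.
have ubd t u : D u ->
    ((t * u)%:E - lmgf mu t <= (fine (cramer mu u))%:E)%E.
  by move=> Du; rewrite fineK ?fD//; apply: ereal_sup_ubound; exists t.
(* The extended bound itself excludes the value [+oo] at [z]; [fine] would send [-oo] to 0, which
   still lies below the nonnegative right-hand side. *)
suff : (cramer mu z <= (s * fine (cramer mu x) + (1 - s) * fine (cramer mu y))%:E)%E.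
  case: (cramer mu z) => [r| |] //= _; rewrite ?lee_fin //.
  by rewrite addr_ge0// mulr_ge0 ?fine_ge0 ?cramer_ge0// subr_ge0.
apply: ge_ereal_sup => _ [t _ <-].
move: (ubd t x Dx) (ubd t y Dy); case: (lmgf mu t) => [l| |]; last 2 first.
- by move=> _ _; exact: leNye.
- by rewrite leye_eq.
by rewrite -!EFinB !lee_fin => hx hy; rewrite /z; nra.
Qed.

(** * The tail function and the mass beyond the endpoint *)

Definition tail {R : realType} (mu : probability R R) (x : R) : R :=
  fine (mu `[x, +oo[%classic).

Lemma tailE {R : realType} (mu : probability R R) (x : R) :
  (tail mu x)%:E = mu `[x, +oo[%classic.
Proof. by rewrite /tail fineK// fin_num_measure. Qed.

Lemma tail_ge0 {R : realType} (mu : probability R R) (x : R) : 0 <= tail mu x.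
Proof. by rewrite fine_ge0. Qed.

Lemma tail_le1 {R : realType} (mu : probability R R) (x : R) : tail mu x <= 1.
Proof. by rewrite -lee_fin tailE probability_le1. Qed.

Lemma tail_antitone {R : realType} (mu : probability R R) (x y : R) :
  x <= y -> tail mu y <= tail mu x.
Proof.
move=> xy; rewrite -lee_fin !tailE le_measure ?inE//.
by move=> z /=; rewrite !in_itv/= !andbT; exact: le_trans.
Qed.

Lemma neglogtail_ge0 {R : realType} (mu : probability R R) (x : R) :
  0 <= neglogtail mu x.
Proof. by rewrite oppr_ge0 ln_le0// tail_le1. Qed.

Lemma expR_neglogtail {R : realType} (mu : probability R R) (x : R) :
  0 < tail mu x -> expR (- neglogtail mu x) = tail mu x.
Proof. by move=> t0; rewrite /neglogtail opprK lnK. Qed.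

Lemma tail_gt0 {R : realType} (mu : probability R R) (x : R) :
  (x%:E < right_endpoint mu)%E -> 0 < tail mu x.
Proof.
move=> /ereal_sup_gt[_ [y sy <-]]; rewrite lte_fin => xy.
rewrite -lte_fin tailE; apply: (@lt_le_trans _ _ (mu `]x, +oo[%classic)).
  apply: sy; first exact: interval_open.
  by rewrite /= in_itv/= xy.
rewrite le_measure ?inE//.
by move=> z /=; rewrite !in_itv/= !andbT; exact: ltW.
Qed.

Lemma measure_bigcup_le {R : realType} (mu : probability R R) (F : (set R)^nat)
    (c : \bar R) :
  (forall n, measurable (F n)) -> {homo F : n m / (n <= m)%N >-> n `<=` m} ->
  (forall n, (mu (F n) <= c)%E) -> (mu (\bigcup_n F n) <= c)%E.
Proof.
move=> mF hF Fc.
have /cvge_to_le : mu (F n) @[n --> \oo] --> mu (\bigcup_n F n).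
  apply: nondecreasing_cvg_mu => //; first exact: bigcup_measurable.
  by move=> n m nm; apply/subsetPset; exact: hF.
by apply; apply: nearW.
Qed.

Lemma measure_bigcap_ge {R : realType} (mu : probability R R) (F : (set R)^nat)
    (c : \bar R) :
  (forall n, measurable (F n)) -> {homo F : n m / (n <= m)%N >-> m `<=` n} ->
  (forall n, (c <= mu (F n))%E) -> (c <= mu (\bigcap_n F n))%E.
Proof.
move=> mF hF Fc.
have /cvge_to_ge : mu (F n) @[n --> \oo] --> mu (\bigcap_n F n).
  apply: nonincreasing_cvg_mu => //.
  - by rewrite (le_lt_trans (probability_le1 _ _)) ?ltry.
  - exact: bigcap_measurable.
  - by move=> n m nm; apply/subsetPset; exact: hF.
by apply; apply: nearW.
Qed.

(** The rays are closed, so those starting at [r - 1/(n+1)] decrease to the one starting at [r], and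
    continuity from above applies. *)
Lemma tail_left_continuous {R : realType} (mu : probability R R) (r c : R) :
  tail mu r < c -> exists2 b, b < r & tail mu b < c.
Proof.
move=> rc; apply: contrapT => h.
have {h}hb b : b < r -> c <= tail mu b.
  by move=> br; rewrite leNgt; apply/negP => bc; apply: h; exists b.
move: rc; apply/negP; rewrite -leNgt -lee_fin tailE.
have -> : `[r, +oo[%classic = \bigcap_n `[r - n.+1%:R^-1, +oo[%classic.
  apply/seteqP; split => [x /= + n _ /=|x hx /=]; rewrite !in_itv/= !andbT.
    by move=> rx; rewrite (le_trans _ rx)// gerBl invr_ge0.
  apply/ler_addgt0Pr => e e0.
  near \oo => n.
  have := hx n I; rewrite /= in_itv/= andbT lerBlDr => /le_trans; apply.
  rewrite lerD2l ltW//; near: n.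
  exact: (near_infty_natSinv_lt (PosNum e0)).
apply: measure_bigcap_ge => // [n m nm|n].
  move=> x /=; rewrite !in_itv/= !andbT; apply: le_trans.
  by rewrite lerB// lef_pV2 ?posrE ?ltr0n// ler_nat.
by rewrite -tailE lee_fin hb// gtrBl invr_gt0.
Unshelve. all: by end_near. Qed.

Lemma tail_pinfty {R : realType} (mu : probability R R) (c : R) :
  0 < c -> exists x, tail mu x < c.
Proof.
move=> c0; apply: contrapT => h.
have {h}hb b : c <= tail mu b.
  by rewrite leNgt; apply/negP => bc; apply: h; exists b.
have : (c%:E <= mu (\bigcap_n `[n%:R, +oo[%classic))%E.
  apply: measure_bigcap_ge => // [n m nm|n].
    by move=> x /=; rewrite !in_itv/= !andbT; apply: le_trans; rewrite ler_nat.
  by rewrite -tailE lee_fin.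
rewrite [X in mu X](_ : _ = set0) ?measure0 ?lee_fin ?leNgt ?c0//.
rewrite -subset0 => x hx.
have := hx (Num.truncn `|x|).+1 I.
rewrite /= in_itv/= andbT leNgt => /negP; apply.
by rewrite (le_lt_trans (ler_norm _))// truncnS_gt.
Qed.

Lemma measurable_tail_le {R : realType} (mu : probability R R) (c : R) :
  measurable [set y | tail mu y <= c].
Proof.
apply: is_interval_measurable => x y /= xc yc z /andP[xz _].
by rewrite (le_trans _ xc)// tail_antitone.
Qed.

(* [tail mu X] is stochastically larger than a uniform variable when [X]
   has law [mu]. *)
Lemma measure_tail_le {R : realType} (mu : probability R R) (c : R) :
  0 <= c -> (mu [set y | (tail mu y <= c)%R] <= c%:E)%E.
Proof.
move=> c0; set U := (X in mu X).
have upU x y : U x -> x <= y -> U y.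
  by move=> Ux xy; apply: le_trans Ux; exact: tail_antitone.
(* [U] is upward closed, hence an increasing union of rays starting at points of [U], each of mass
   at most [c]. The sequence [z] is constant if the infimum is attained, and otherwise decreases to
   the infimum or to [-oo]. *)
have cover (z : nat -> R) : (forall n, U (z n)) ->
    {homo z : n m / (n <= m)%N >-> (m <= n)} ->
    (forall y, U y -> exists n, z n <= y) -> (mu U <= c%:E)%E.
  move=> Uz hz zU.
  have -> : U = \bigcup_n `[z n, +oo[%classic.
    apply/seteqP; split => [y /zU[n zy]|y [n _ /=]].
      by exists n => //=; rewrite in_itv/= zy.
    by rewrite in_itv/= andbT => zy; apply: upU zy; exact: Uz.
  apply: measure_bigcup_le => // [n m nm|n].
    by move=> x /=; rewrite !in_itv/= !andbT; apply: le_trans; exact: hz.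
  by rewrite -tailE lee_fin; exact: Uz.
have [->|/set0P U0] := eqVneq U set0; first by rewrite measure0 lee_fin.
have [lU|nlU] := pselect (has_lbound U).
- have [iU|niU] := pselect (U (inf U)).
    apply: (cover (fun=> inf U)) => // y Uy.
    by exists 0%N; apply: ge_inf.
  apply: (cover (fun n => inf U + n.+1%:R^-1)).
  + move=> n; have [|u Uu /ltW] := @inf_adherent _ U n.+1%:R^-1 _ (conj U0 lU).
      by rewrite invr_gt0.
    exact: upU.
  + by move=> n m nm; rewrite lerD2l lef_pV2 ?posrE ?ltr0n// ler_nat.
  + move=> y Uy.
    have iy : 0 < y - inf U.
      rewrite subr_gt0 lt_neqAle ge_inf// andbT.
      by apply/eqP => iy; apply: niU; rewrite iy.
    near \oo => n; exists n.
    rewrite -lerBrDl ltW//; near: n.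
    exact: (near_infty_natSinv_lt (PosNum iy)).
- apply: (cover (fun n => - n%:R)).
  + move=> n; apply: contrapT => nU; apply: nlU; exists (- n%:R) => y Uy.
    by rewrite leNgt; apply/negP => /ltW /(upU _ _ Uy).
  + by move=> n m nm; rewrite lerN2 ler_nat.
  + move=> y _; exists (Num.truncn `|y|).+1.
    by rewrite lerNl ltW// (le_lt_trans (ler_norm _))// normrN truncnS_gt.
Unshelve. all: by end_near. Qed.

(** Each point beyond [r] is outside the support, so it has a null open neighbourhood, which
    contains a rational interval around the point; there are only countably many of these. *)
Lemma measure_gt_right_endpoint {R : realType} (mu : probability R R) (r : R) :
  right_endpoint mu = r%:E -> mu `]r, +oo[%classic = 0%E.
Proof.
move=> xr.
(* Enumerates the null intervals with rational ends through the codes of pairs; every other code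
   gives the empty set. *)
pose F (n : nat) : set R := if @unpickle (rat * rat)%type n is Some (p, q) then
  (if mu `](ratr p : R), (ratr q : R)[%classic == 0%E then `]ratr p, ratr q[%classic else set0)
  else set0.
have F0 : mu.-negligible (\bigcup_n F n).
  apply: negligible_bigcup => n; rewrite /F.
  case: unpickle => [[p q]|]; last exact: negligible_set0.
  case: eqP => [h|_]; last exact: negligible_set0.
  exact/negligibleP.
apply: measure_negligible => //; apply: negligibleS F0.
move=> y /=; rewrite in_itv/= andbT => ry.
have [U oU [Uy U0]] : exists2 U : set R, open U & U y /\ mu U = 0%E.
  apply: contrapT => h.
  suff : (y%:E <= right_endpoint mu)%E by rewrite xr lee_fin leNgt ry.
  apply: ereal_sup_ubound; exists y => // U oU Uy.
  rewrite lt0e measure_ge0 andbT; apply/eqP => U0.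
  by apply: h; exists U.
have [e /= e0 eU] : nbhs_ball y U by apply/nbhs_ballP; exact: open_nbhs_nbhs.
have [p] : exists p : rat, ratr p \in `]y - e, y[ by apply: rat_in_itvoo; lra.
have [q] : exists q : rat, ratr q \in `]y, y + e[ by apply: rat_in_itvoo; lra.
rewrite !in_itv/= => /andP[yq qe] /andP[ep py].
exists (pickle (p, q)); [exact: I|rewrite /F pickleK].
case: eqP => [_|]; first by rewrite /= in_itv/= py yq.
case; apply/eqP; rewrite -measure_le0 -U0 le_measure ?inE//.
  exact: open_measurable.
move=> z /=; rewrite in_itv/= => /andP[pz zq]; apply: eU.
by rewrite /ball/= ltr_norml; apply/andP; split; lra.
Qed.

(** * Centred exponential moments and bounds on the Cramer transform *)

(** When it is positive and finite, minus its logarithm is [t * x - lmgf mu t], the term of [t] in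
    the supremum defining [cramer mu x]. *)
Definition mgf_at {R : realType} (mu : probability R R) (x t : R) : \bar R :=
  (\int[mu]_y (expR (t * (y - x)))%:E)%E.

Lemma measurable_expR_affine {R : realType} (D : set R) (t x : R) :
  measurable_fun D (fun y : R => (expR (t * (y - x)))%:E).
Proof.
apply/measurable_EFinP; apply: measurableT_comp; first exact: measurable_expR.
by apply: measurable_funM => //; exact: measurable_funB.
Qed.

Lemma mgf_at_ge0 {R : realType} (mu : probability R R) (x t : R) :
  (0 <= mgf_at mu x t)%E.
Proof. by apply: integral_ge0 => y _; rewrite lee_fin expR_ge0. Qed.

Lemma mgf_at_shift {R : realType} (mu : probability R R) (x z t : R) :
  mgf_at mu z t = ((expR (t * (x - z)))%:E * mgf_at mu x t)%E.
Proof.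
have m := @measurable_expR_affine R setT t x.
have p y : setT y -> (0 <= (expR (t * (y - x)))%:E)%E by rewrite lee_fin expR_ge0.
rewrite /mgf_at -(ge0_integralZl_EFin mu measurableT p m (expR_ge0 _)).
by apply: eq_integral => y _; rewrite -EFinM -expRD; congr (expR _)%:E; ring.
Qed.

(** Positivity keeps [ln] away from its default value 0 at 0, so that the logarithm of the shifted
    product splits. *)
Lemma lmgfE {R : realType} (mu : probability R R) (x t : R) :
  (0 < mgf_at mu x t)%E ->
  lmgf mu t = if mgf_at mu x t is EFin r then (t * x + ln r)%:E else +oo%E.
Proof.
move=> r0; rewrite /lmgf.
under eq_integral => y _ do rewrite -[y in t * y]subr0.
rewrite -/(mgf_at mu 0 t) (mgf_at_shift _ x) subr0.
case: (mgf_at mu x t) r0 => [r| |]//=; last by rewrite gt0_muley ?lte_fin ?expR_gt0.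
by rewrite lte_fin => r0; rewrite lnM ?posrE ?expR_gt0// expRK.
Qed.

Lemma lmgf_ge {R : realType} (mu : probability R R) (x t u : R) :
  ((expR u)%:E <= mgf_at mu x t)%E -> ((t * x + u)%:E <= lmgf mu t)%E.
Proof.
move=> uM; have M0 : (0 < mgf_at mu x t)%E.
  by apply: lt_le_trans uM; rewrite lte_fin expR_gt0.
rewrite (lmgfE _ x)//; case: (mgf_at mu x t) uM M0 => [r| |]//=.
- rewrite !lee_fin lte_fin => ur r0.
  by rewrite lerD2l -[u]expRK ler_ln ?posrE ?expR_gt0.
- by move=> _ _; rewrite leey.
Qed.

Lemma lmgf_le {R : realType} (mu : probability R R) (x t u : R) :
  (0 < mgf_at mu x t <= (expR u)%:E)%E -> (lmgf mu t <= (t * x + u)%:E)%E.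
Proof.
move=> /andP[M0 uM]; rewrite (lmgfE _ x)//.
case: (mgf_at mu x t) uM M0 => [r| |]//=.
rewrite !lee_fin lte_fin => ur r0.
by rewrite lerD2l -[u]expRK ler_ln ?posrE ?expR_gt0.
Qed.

Lemma tail_le_mgf_at {R : realType} (mu : probability R R) (x t : R) :
  0 <= t -> ((tail mu x)%:E <= mgf_at mu x t)%E.
Proof.
move=> t0; rewrite tailE -[X in mu X]setIT -integral_indic//.
apply: ge0_le_integral => //.
- exact/measurable_EFinP/measurable_indic.
- exact: measurable_expR_affine.
- move=> y _; rewrite lee_fin indicE.
  case: (boolP (y \in _)) => [|_]; last by rewrite expR_ge0.
  rewrite inE/= in_itv/= andbT => xy.
  by rewrite -expR0 ler_expR mulr_ge0// subr_ge0.
Qed.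

(* A substitute for Jensen's inequality that does not mention the mean, which
   may fail to exist: [t0 e^(t y) - t e^(t0 y) >= t0 - t] pointwise. *)
Lemma mgf_at_ge1 {R : realType} (mu : probability R R) (x t0 t : R) :
  0 < t0 -> t < 0 -> (mgf_at mu x t0 <= 1)%E -> (1 <= mgf_at mu x t)%E.
Proof.
move=> t00 t_lt0 M1.
have key : ((t0 - t)%:E <= t0%:E * mgf_at mu x t + (- t)%:E * mgf_at mu x t0)%E.
  have -> : (t0 - t)%:E = (\int[mu]_y (cst (t0 - t)%:E y))%E.
    by rewrite integral_cst// [X in (_ * X)%E]probability_setT mule1.
  have m s : measurable_fun setT (fun y : R => (expR (s * (y - x)))%:E).
    exact: measurable_expR_affine.
  have p (c s y : R) : 0 <= c -> (0 <= c%:E * (expR (s * (y - x)))%:E)%E.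
    by move=> c0; rewrite lee_fin mulr_ge0// expR_ge0.
  have mc (c s : R) :
      measurable_fun setT (fun y : R => (c%:E * (expR (s * (y - x)))%:E)%E).
    by apply: measurable_funeM; exact: m.
  rewrite /mgf_at -!ge0_integralZl_EFin//; [|lra|lra].
  rewrite -ge0_integralD//; try by move=> y _; apply: p; lra.
  apply: ge0_le_integral => //.
  - by move=> y _; rewrite lee_fin; lra.
  - by apply: emeasurable_funD; exact: mc.
  - move=> y _; rewrite lee_fin.
    (* The linear terms of the two tangent bounds cancel under the positive weights [t0] and
       [- t]. *)
    have := expR_ge1Dx (t * (y - x)); have := expR_ge1Dx (t0 * (y - x)).
    nra.
move: key M1 (mgf_at_ge0 mu x t0) (mgf_at_ge0 mu x t).
case: (mgf_at mu x t0) => [B| |]//; case: (mgf_at mu x t) => [A| |]//; last first.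
  by move=> *; rewrite leey.
by rewrite -!EFinM -EFinD !lee_fin => key B1 B0 _; nra.
Qed.

(** Markov's inequality handles [t >= 0]. For [t < 0], the moment bound at [x0] gives
    [lmgf mu t >= t * x0 >= t * x], so the term is at most 0. *)
Lemma cramer_le_neglogtail {R : realType} (mu : probability R R) (x0 t0 x : R) :
  0 < t0 -> (mgf_at mu x0 t0 <= 1)%E -> x0 <= x -> 0 < tail mu x ->
  (cramer mu x <= (neglogtail mu x)%:E)%E.
Proof.
move=> t00 M1 x0x Tx; apply: ge_ereal_sup => _ [t _ <-].
have conclude u : (u%:E <= lmgf mu t)%E -> t * x <= neglogtail mu x + u ->
    ((t * x)%:E - lmgf mu t <= (neglogtail mu x)%:E)%E.
  case: (lmgf mu t) => [l| |]//=; last by move=> _ _; exact: leNye.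
  by rewrite -EFinB !lee_fin => ul tx; lra.
have [t_ge0|t_lt0] := leP 0 t.
- apply: (conclude (t * x - neglogtail mu x)); last lra.
  apply: lmgf_ge; rewrite expR_neglogtail//; exact: tail_le_mgf_at.
- apply: (conclude (t * x0 + 0)).
    by apply: lmgf_ge; rewrite expR0; exact: (mgf_at_ge1 _ _ t0).
  have := neglogtail_ge0 mu x; nra.
Qed.

Lemma cramer_ge {R : realType} (mu : probability R R) (x t u : R) :
  0 <= t -> 0 < tail mu x -> (mgf_at mu x t <= (expR (- u))%:E)%E ->
  (u%:E <= cramer mu x)%E.
Proof.
move=> t0 Tx M; apply: (@le_trans _ _ ((t * x)%:E - lmgf mu t)%E); last first.
  by apply: ereal_sup_ubound; exists t.
have : (lmgf mu t <= (t * x - u)%:E)%E.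
  apply: lmgf_le; rewrite M andbT (lt_le_trans _ (tail_le_mgf_at _ x _ t0))//.
case: (lmgf mu t) => [l| |]//; last by move=> _; exact: leey.
by rewrite -EFinB !lee_fin => ?; lra.
Qed.

Lemma cramer_equiv {R : realType} (mu : probability R R) :
  (forall eta : R, 0 < eta < 1 -> eventually_left (right_endpoint mu) (fun x =>
     exists2 t : R, 0 < t &
       (mgf_at mu x t <= (expR (- (eta * neglogtail mu x)))%:E)%E)) ->
  eventually_left (right_endpoint mu) (fun x => 0 < neglogtail mu x) ->
  lim_left (right_endpoint mu) (fun x => neglogtail mu x / fine (cramer mu x)) 1.
Proof.
move=> H Npos; apply/lim_leftP => e e0.
(* Any [eta] would supply the point needed for the upper bound, because [neglogtail] is
   nonnegative. *)
have [x0 x0x [t0 t00 M0]] : exists2 x0, (x0%:E < right_endpoint mu)%E &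
    exists2 t : R, 0 < t & (mgf_at mu x0 t <= 1)%E.
  have /H/eventually_left_ex[x0 x0x [t0 t00 M0]] : 0 < (1 / 2 : R) < 1.
    by apply/andP; split; lra.
  exists x0 => //; exists t0 => //; apply: le_trans M0 _.
  by rewrite lee_fin -expR0 ler_expR oppr_le0 mulr_ge0// neglogtail_ge0.
(* The midpoint of [1 / (1 + e)] and 1, so that [1 / eta < 1 + e] strictly. *)
pose eta := (1 + e)^-1 + (1 - (1 + e)^-1) / 2.
have e1 : (1 + e)^-1 < 1 by rewrite invf_lt1; lra.
have e1' : 0 < (1 + e)^-1 by rewrite invr_gt0; lra.
have /H HH : 0 < eta < 1 by apply/andP; rewrite /eta; split; lra.
have E := eventually_leftI _ _ _ HH (eventually_leftI _ _ _ Npos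
  (eventually_left_gt _ _ x0x)).
apply: (eventually_leftW _ _ _ _ E) => x xx [[t tp M] [N0 x0x']].
have Tx := tail_gt0 _ _ xx.
have L1 : (cramer mu x <= (neglogtail mu x)%:E)%E.
  exact: (cramer_le_neglogtail _ x0 t0 _ t00 M0 (ltW x0x') Tx).
have L2 : ((eta * neglogtail mu x)%:E <= cramer mu x)%E.
  exact: (cramer_ge _ _ t _ (ltW tp) Tx M).
move: L1 L2; case: (cramer mu x) => [l| |]//=.
rewrite !lee_fin => L1 L2.
have eta0 : (1 + e)^-1 < eta by rewrite /eta; lra.
have le : neglogtail mu x < (1 + e) * l.
  have h : (1 + e)^-1 * neglogtail mu x < l.
    by apply: lt_le_trans L2; rewrite ltr_pM2r.
  by rewrite -ltr_pdivrMl ?h//; lra.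
have l0 : 0 < l by nra.
rewrite ltr_norml -(ltr_pM2r l0) -[X in _ && X](ltr_pM2r l0) mulrBl mulfVK ?gt_eqF//.
by apply/andP; split; nra.
Qed.

(** * Exponential moments of the logarithmic tail *)

Lemma nneseries_geometric_lty {R : realType} (a z : R) :
  0 <= a -> 0 < z < 1 -> (\sum_(0 <= k <oo) (a * z ^+ k)%:E < +oo)%E.
Proof.
move=> a0 /andP[z0 z1].
apply: (@le_lt_trans _ _ (a * (1 - z)^-1)%:E); last exact: ltry.
apply: lime_le.
  by apply: is_cvg_nneseries => n _ _; rewrite lee_fin mulr_ge0// exprn_ge0// ltW.
apply: nearW => n; rewrite sumEFin lee_fin.
have := @geometric_le_lim R n a z a0 z0.
by rewrite gtr0_norm// => /(_ z1).
Qed.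

(** Writing [N] for [neglogtail mu], the majorant [H] is the sum over [k] of [e^(q (k+1))] on the
    event [N >= k], of mass at most [e^(-k)]; the integrals are dominated by a geometric series of
    ratio [e^(q - 1)]. *)
Lemma neglogtail_exp_moment {R : realType} (mu : probability R R) (q : R) :
  0 < q < 1 -> exists H : R -> \bar R,
  [/\ measurable_fun setT H, forall y, (0 <= H y)%E, (\int[mu]_y H y < +oo)%E &
      forall y, 0 < tail mu y -> ((expR (q * neglogtail mu y))%:E <= H y)%E].
Proof.
move=> /andP[q0 q1].
(* Stated through the tail, so that points of zero tail belong to every [U k]; there [neglogtail]
   would be the default 0. *)
pose U (k : nat) := [set y | tail mu y <= expR (- k%:R)].
have mU k : measurable (U k) by exact: measurable_tail_le.
pose h (k : nat) (y : R) : \bar R := ((expR (q * k.+1%:R))%:E * (\1_(U k) y)%:E)%E.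
have h0 k y : (0 <= h k y)%E by rewrite mule_ge0// lee_fin ?expR_ge0.
have m1 k : measurable_fun setT (fun y : R => (\1_(U k) y : R)%:E).
  exact/measurable_EFinP/measurable_indic.
have mh k : measurable_fun setT (h k) by exact: measurable_funeM.
exists (fun y => (\sum_(0 <= k <oo) h k y)%E); split.
- by apply: (ge0_emeasurable_sum (P := xpredT)).
- by move=> y; apply: nneseries_ge0.
- rewrite integral_nneseries//.
  apply: (@le_lt_trans _ _ (\sum_(0 <= k <oo) (expR q * expR (q - 1) ^+ k)%:E)%E).
    apply: lee_nneseries => [k _ _|k _]; first exact: integral_ge0.
    rewrite /h (ge0_integralZl_EFin mu measurableT _ (m1 k) (expR_ge0 _))//.
    rewrite integral_indic// setIT.
    apply: (@le_trans _ _ ((expR (q * k.+1%:R))%:E * (expR (- k%:R))%:E)%E).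
      rewrite lee_pmul2l ?lte_fin ?expR_gt0//.
      by apply: measure_tail_le; exact: expR_ge0.
    rewrite -EFinM lee_fin -expRM_natl -!expRD ler_expR -natr1; lra.
  apply: nneseries_geometric_lty; first exact: expR_ge0.
  by rewrite expR_gt0 expR_lt1 subr_lt0.
- move=> y Ty; set N := neglogtail mu y.
  have N0 : 0 <= N by exact: neglogtail_ge0.
  have Uy : U (Num.truncn N) y.
    by rewrite /U/= -expR_neglogtail// ler_expR lerN2 truncn_le.
  (* With [k] the integer part of [N], [k <= N] puts [y] in [U k] and [N < k + 1] makes this single
     term large enough. *)
  apply: (@le_trans _ _ (h (Num.truncn N) y)).
    rewrite /h indicE mem_set// mule1 lee_fin ler_expR ler_pM2l//.
    by rewrite ltW// truncnS_gt.
  apply: le_trans (nneseries_lim_ge (Num.truncn N).+1 _) => //.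
  by rewrite big_nat_recr//= leeDr// sume_ge0.
Qed.

(** * The case of a tail vanishing at the endpoint *)

Lemma measurable_ge_ereal {R : realType} (xs : \bar R) :
  measurable [set y : R | (xs <= y%:E)%E].
Proof.
apply: is_interval_measurable => x y /= xx _ z /andP[xz _].
by rewrite (le_trans xx)// lee_fin.
Qed.

(** The set lies in every ray starting below [xs]. Integrands then need bounding only below the
    endpoint, where [V] is controlled. *)
Lemma measure_ge_vanishing_tail {R : realType} (mu : probability R R)
    (xs : \bar R) :
  (forall c, 0 < c -> exists2 x, (x%:E < xs)%E & tail mu x < c) ->
  mu [set y : R | (xs <= y%:E)%E] = 0%E.
Proof.
move=> van; apply/eqP; rewrite eq_le measure_ge0 andbT.
apply/lee_addgt0Pr => e e0; rewrite add0e.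
have [x xx xe] := van e e0.
apply: (@le_trans _ _ (tail mu x)%:E); last by rewrite lee_fin ltW.
rewrite tailE le_measure ?inE//; first exact: measurable_ge_ereal.
by move=> y /= xy; rewrite in_itv/= andbT -lee_fin (le_trans (ltW xx)).
Qed.

Lemma eventually_neglogtail_gt {R : realType} (mu : probability R R) (M : R) :
  (forall c, 0 < c ->
    exists2 x, (x%:E < right_endpoint mu)%E & tail mu x < c) ->
  eventually_left (right_endpoint mu) (fun x => M < neglogtail mu x).
Proof.
move=> /(_ _ (expR_gt0 (- M)))[x1 x1x t1]; exists x1 => // x xx1 xx.
rewrite -ltrN2 -ltr_expR expR_neglogtail; last exact: tail_gt0.
by apply: le_lt_trans t1; apply: tail_antitone; exact: ltW.
Qed.

(* Tilting by [q^2] times a subgradient [s] of [V] at [x]: for [b < y],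
   [q^2 s (y - x) <= q^2 (V y - V x) <= q N y - q^2 V x]. *)
Lemma mgf_at_tilted {R : realType} (mu : probability R R) (V : R -> R)
    (H : R -> \bar R) (a b x q : R) :
  let xs := right_endpoint mu in
  convex_on [set x : R | (a%:E < x%:E)%E /\ (x%:E < xs)%E] V ->
  mu [set y : R | (xs <= y%:E)%E] = 0%E ->
  measurable_fun setT H -> (forall y, (0 <= H y)%E) ->
  (forall y, 0 < tail mu y -> ((expR (q * neglogtail mu y))%:E <= H y)%E) ->
  0 < q < 1 -> a < b -> b < x -> (x%:E < xs)%E -> V b < V x ->
  (forall y, b < y -> (y%:E < xs)%E -> q * V y <= neglogtail mu y) ->
  exists2 t : R, 0 < t &
    (mgf_at mu x t <= (expR (- (q ^+ 2 * V x)))%:E *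
                      (\int[mu]_y H y + (expR (q ^+ 2 * V b))%:E))%E.
Proof.
move=> xs cV null mH H0 HN /andP[q0 q1] ab bx xx Vbx qVN.
have [z0 xz0 z0x] := lt_ereal_dense _ _ xx.
have [s hs] : exists s, forall y, [set x : R | (a%:E < x%:E)%E /\ (x%:E < xs)%E] y ->
    V x + s * (y - x) <= V y.
  apply: (@convex_on_subgradient _ _ _ _ b z0 cV) => /=; rewrite ?lte_fin.
  - by split => //; exact: lt_trans bx.
  - by split => //; apply: lt_trans xx; rewrite lte_fin.
  - by split => //; apply: lt_trans xz0; exact: lt_trans bx.
  - by rewrite bx.
have Db : V x + s * (b - x) <= V b.
  by apply: hs => /=; rewrite lte_fin; split => //; apply: lt_trans xx; rewrite lte_fin.
(* The subgradient inequality at [b] reads [s * (x - b) >= V x - V b > 0]. *)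
have s0 : 0 < s by nra.
have qq0 : 0 < q ^+ 2 by rewrite exprn_gt0.
exists (q ^+ 2 * s); first by rewrite mulr_gt0.
set C := (expR (q ^+ 2 * V b))%:E.
have -> : (\int[mu]_y H y + C = \int[mu]_y (H y + C))%E.
  rewrite ge0_integralD//; last by move=> y _; rewrite lee_fin expR_ge0.
  by rewrite integral_cst// [X in (_ * X)%E]probability_setT mule1.
have HC0 y : (0 <= H y + C)%E by rewrite adde_ge0// lee_fin expR_ge0.
have mHC : measurable_fun setT (fun y => (H y + C)%E).
  by apply: emeasurable_funD.
rewrite -(ge0_integralZl_EFin mu measurableT (fun y _ => HC0 y) mHC (expR_ge0 _)).
apply: ae_ge0_le_integral => //.
- exact: measurable_expR_affine.
- by move=> y _; rewrite mule_ge0// lee_fin expR_ge0.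
- exact: measurable_funeM.
exists [set y : R | (xs <= y%:E)%E]; split => //; first exact: measurable_ge_ereal.
move=> y /= ny; rewrite leNgt; apply/negP => yx; apply: ny => _.
(* Left of [b], where [y] may leave the domain of [V], monotonicity in [y] reduces to the bound at
   [b]; this produces the constant [C]. Right of [b], [H] dominates. *)
have [yb|by_] := leP y b.
- apply: (@le_trans _ _ ((expR (- (q ^+ 2 * V x)))%:E * C)%E).
    rewrite -EFinM -expRD lee_fin ler_expR.
    have : s * (y - x) <= V b - V x by nra.
    by move=> /(ler_wpM2l (ltW qq0)); lra.
  by rewrite lee_pmul2l ?lte_fin ?expR_gt0// leeDr.
- apply: (@le_trans _ _ ((expR (- (q ^+ 2 * V x)))%:E *
                         (expR (q * neglogtail mu y))%:E)%E).
    rewrite -EFinM -expRD lee_fin ler_expR.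
    have : V x + s * (y - x) <= V y.
      by apply: hs => /=; rewrite lte_fin; split => //; exact: lt_trans by_.
    move=> /(ler_wpM2l (ltW qq0)).
    have /(ler_wpM2l (ltW q0)) := qVN _ by_ yx; rewrite mulrA -expr2; lra.
  rewrite lee_pmul2l ?lte_fin ?expR_gt0//.
  apply: (le_trans (HN _ (tail_gt0 _ _ yx))).
  by rewrite leeDl// lee_fin expR_ge0.
Qed.

Lemma near1_ratio {R : realType} (n v u : R) :
  0 < u < 1 -> 0 <= n -> `|n / v - 1| < u ->
  [/\ 0 < v, 0 < n, (1 - u) * v <= n & (1 - u) * n <= v].
Proof.
move=> /andP[u0 u1] n0; rewrite ltr_norml => /andP[h1 h2].
have nv : 0 < n / v by lra.
have v0 : 0 < v.
  rewrite ltNge; apply/negP => v0; move: nv; apply/negP; rewrite -leNgt.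
  by rewrite mulr_ge0_le0// invr_le0.
have e : n = (n / v) * v by rewrite mulfVK// gt_eqF.
have e1 : (1 - u) * v <= n by rewrite e ler_pM2r//; lra.
have e2 : n <= (1 + u) * v by rewrite e ler_pM2r//; lra.
(* The last bound is [(1 - u) * n <= (1 - u) * (1 + u) * v <= v]. *)
split => //; nra.
Qed.

Lemma mgf_at_vanishing_tail {R : realType} (mu : probability R R)
    (V : R -> R) (a : R) :
  let xs := right_endpoint mu in
  (a%:E < xs)%E ->
  convex_on [set x : R | (a%:E < x%:E)%E /\ (x%:E < xs)%E] V ->
  lim_left xs (fun x => neglogtail mu x / V x) 1 ->
  (forall c, 0 < c -> exists2 x, (x%:E < xs)%E & tail mu x < c) ->
  forall eta : R, 0 < eta < 1 -> eventually_left xs (fun x =>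
     exists2 t : R, 0 < t &
       (mgf_at mu x t <= (expR (- (eta * neglogtail mu x)))%:E)%E).
Proof.
move=> xs axs cV /lim_leftP lV van eta /andP[eta0 eta1].
(* Tilting costs two factors [q] and passing from [V] back to [neglogtail] a third;
   [(1 - u)^3 >= 1 - 3 u > 1 - 4 u = eta] leaves room for them. *)
pose u := (1 - eta) / 4; pose q := 1 - u.
have u01 : 0 < u < 1 by apply/andP; rewrite /u; split; lra.
have q01 : 0 < q < 1 by move/andP: u01 => [? ?]; apply/andP; rewrite /q; split; lra.
have q3 : eta < q ^+ 3.
  rewrite /q; have [? ?] := andP u01.
  have -> : eta = 1 - 4 * u by rewrite /u; field.
  by rewrite !exprS expr0; nra.
have [H [mH H0 Hfin HN]] := neglogtail_exp_moment mu q q01.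
have null := measure_ge_vanishing_tail mu xs van.
have [b0 b0x hb0] := lV u (andP u01).1.
have rat y : b0 < y -> (y%:E < xs)%E ->
    [/\ 0 < V y, 0 < neglogtail mu y, q * V y <= neglogtail mu y &
        q * neglogtail mu y <= V y].
  by move=> by_ yx; apply: near1_ratio => //; [exact: neglogtail_ge0|exact: hb0].
have [b mb bx] : exists2 b, Num.max a b0 < b & (b%:E < xs)%E.
  by apply: lt_ereal_dense; case: (leP a b0).
move: mb; rewrite gt_max => /andP[ab b0b].
have [k k0 Hk] : exists2 k, 0 <= k & (\int[mu]_y H y)%E = k%:E.
  have Hge0 : (0 <= \int[mu]_y H y)%E by exact: integral_ge0.
  move: Hfin Hge0; case: (\int[mu]_y H y)%E => [k| |]//= _; rewrite lee_fin => k0.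
  by exists k.
pose C := k + expR (q ^+ 2 * V b).
have C0 : 0 < C by rewrite ltr_wpDl// expR_gt0.
(* The first threshold forces [V b < V x]; the second lets the gap [q ^+ 3 - eta] absorb the
   constant [C]. *)
have E1 := eventually_neglogtail_gt mu (V b / q) van.
have E2 := eventually_neglogtail_gt mu (ln C / (q ^+ 3 - eta)) van.
have E := eventually_leftI _ _ _ (eventually_left_gt _ _ bx)
  (eventually_leftI _ _ _ E1 E2).
apply: (eventually_leftW _ _ _ _ E) => x xx [bx' [N1 N2]].
have [q0 q1] := andP q01.
have [V0 N0 qV qN] := rat _ (lt_trans b0b bx') xx.
have Vbx : V b < V x.
  apply: lt_le_trans qN; move: N1; rewrite ltr_pdivrMr//; lra.
have qVN y : b < y -> (y%:E < xs)%E -> q * V y <= neglogtail mu y.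
  by move=> by_ yx; have [] := rat y (lt_trans b0b by_) yx.
have [t t0 Mt] := mgf_at_tilted mu V H a b x q cV null mH H0 HN q01 ab bx' xx Vbx qVN.
exists t => //; apply: (le_trans Mt).
rewrite Hk -EFinD -EFinM lee_fin -/C -[C in X in X <= _]lnK ?posrE//.
rewrite -expRD ler_expR.
have : ln C < neglogtail mu x * (q ^+ 3 - eta).
  by rewrite -ltr_pdivrMr// subr_gt0.
have : q ^+ 3 * neglogtail mu x <= q ^+ 2 * V x.
  by rewrite exprSr -mulrA ler_pM2l// exprn_gt0.
lra.
Qed.

(** * The case of an atom at a finite endpoint *)

(** The integrand is at most 1 between [b] and [r], at most [e^(t (b - r))] below [b], and the
    points beyond [r] are null. *)
Lemma mgf_at_endpoint_le {R : realType} (mu : probability R R) (r b t : R) :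
  right_endpoint mu = r%:E -> 0 <= t ->
  (mgf_at mu r t <= (tail mu b + expR (t * (b - r)))%:E)%E.
Proof.
move=> xr t0.
have m1 : measurable_fun setT (fun y : R => (\1_(`[b, +oo[%classic) y : R)%:E).
  exact/measurable_EFinP/measurable_indic.
have -> : ((tail mu b + expR (t * (b - r)))%:E =
    \int[mu]_y ((\1_(`[b, +oo[%classic) y : R)%:E + (expR (t * (b - r)))%:E))%E.
  rewrite ge0_integralD//.
  rewrite integral_indic// setIT integral_cst//.
  by rewrite [X in (_ + _ * X)%E]probability_setT mule1 EFinD tailE.
apply: ae_ge0_le_integral => //.
- exact: measurable_expR_affine.
- by move=> y _; rewrite adde_ge0// lee_fin ?expR_ge0.
- exact: emeasurable_funD.
exists `]r, +oo[%classic; split => //; first exact: measure_gt_right_endpoint.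
move=> y /= ny; rewrite in_itv/= andbT ltNge; apply/negP => yr; apply: ny => _.
rewrite -EFinD lee_fin indicE.
have [yb|by_] := ltP y b.
  apply: (@le_trans _ _ (expR (t * (b - r)))); last by rewrite lerDr.
  by rewrite ler_expR ler_wpM2l// lerD2r ltW.
rewrite mem_set/=; last by rewrite in_itv/= by_.
apply: (@le_trans _ _ 1); last by rewrite lerDl expR_ge0.
by rewrite -expR0 ler_expR mulr_ge0_le0// subr_le0.
Qed.

Lemma mgf_at_atom {R : realType} (mu : probability R R) (r : R) :
  right_endpoint mu = r%:E -> 0 < tail mu r -> 0 < neglogtail mu r ->
  forall eta : R, 0 < eta < 1 -> eventually_left r%:E (fun x =>
     exists2 t : R, 0 < t &
       (mgf_at mu x t <= (expR (- (eta * neglogtail mu x)))%:E)%E).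
Proof.
move=> xr Tr Nr eta /andP[eta0 eta1].
(* Here [d] is [c] to the power [eta], larger than [c] because [0 < c < 1]. The gap is shared
   between the tail at [b], below [c1], and the exponential error [delta], with [c1 + delta < d]. *)
set c := tail mu r; set d := expR (- (eta * neglogtail mu r)).
have cd : c < d by rewrite /c -expR_neglogtail// ltr_expR; nra.
pose c1 := (c + d) / 2; pose delta := (d - c1) / 2.
have delta0 : 0 < delta by rewrite /delta /c1; lra.
have [b br bc1] : exists2 b, b < r & tail mu b < c1.
  by apply: tail_left_continuous; rewrite -/c /c1; lra.
(* Chosen so that [t * (b - r) <= ln delta]; the summand 1 keeps [t] positive when [ln delta] is
   0. *)
pose t := (1 + `|ln delta|) / (r - b).
have t0 : 0 < t by rewrite divr_gt0 ?subr_gt0// ltr_pwDl.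
have tb : expR (t * (b - r)) <= delta.
  rewrite -[leRHS]lnK// ler_expR.
  have -> : t * (b - r) = - (1 + `|ln delta|) 
    by rewrite /t -[b - r]opprB mulrN mulfVK// subr_eq0 gt_eqF.
  have := ler_norm (- ln delta); rewrite normrN; lra.
pose K := c1 + delta.
have K0 : 0 < K by rewrite /K /c1; have := tail_ge0 mu r; rewrite -/c; lra.
have Kd : K < d by rewrite /K /delta /c1; lra.
have MK : (mgf_at mu r t <= K%:E)%E.
  apply: le_trans (mgf_at_endpoint_le mu r b t xr (ltW t0)) _.
  by rewrite lee_fin /K; lra.
have ldK : 0 < ln (d / K) by rewrite ln_gt0// ltr_pdivlMr// mul1r.
(* With [t] fixed, moving the centre from [r] to [x] costs the factor [e^(t (r - x))], at most
   [d / K] in this range. *)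
exists (r - ln (d / K) / t); first by rewrite lte_fin gtrBl divr_gt0.
move=> x rx; rewrite lte_fin => xr'; exists t => //.
rewrite (mgf_at_shift _ r).
apply: (@le_trans _ _ ((d / K)%:E * K%:E)%E).
  apply: lee_pmul => //; rewrite ?mgf_at_ge0 ?lee_fin ?expR_ge0//.
  rewrite -[leRHS]lnK ?posrE ?divr_gt0 ?expR_gt0// ler_expR.
  by rewrite mulrC -ler_pdivlMr//; lra.
rewrite -EFinM mulfVK ?gt_eqF// lee_fin ler_expR lerN2 ler_pM2l//.
rewrite -lerN2 -ler_expR !expR_neglogtail//; first by apply: tail_antitone; exact: ltW.
by apply: tail_gt0; rewrite xr lte_fin.
Qed.

(** * The equivalence *)

Theorem theorem1p2 (R : realType) (mu : probability R R) :
  lim_left (right_endpoint mu)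
    (fun x => neglogtail mu x / fine (cramer mu x)) 1
  <->
  exists (a : R) (V : R -> R),
    (a%:E < right_endpoint mu)%E /\
    convex_on [set x : R | (a%:E < x%:E)%E /\ (x%:E < right_endpoint mu)%E] V /\
    lim_left (right_endpoint mu) (fun x => neglogtail mu x / V x) 1.
Proof.
split=> [lim|[a [V [axs [cV lim]]]]].
- have [a axs ha] := (lim_leftP _ _ _).1 lim _ ltr01.
  exists a, (fun x => fine (cramer mu x)); split => //; split => //.
  apply: cramer_convex => x [/=]; rewrite lte_fin => ax xx.
  (* An infinite value would have [fine] equal to 0 and make the quotient 0, at distance exactly 1
     from the limit. *)
  have := ha x ax xx; case: (cramer mu x) => [l| |]//=;
    by rewrite invr0 mulr0 sub0r normrN normr1 ltxx.
- have Npos : eventually_left (right_endpoint mu) (fun x => 0 < neglogtail mu x).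
    have E := (lim_leftP _ _ _).1 lim (1 / 2) ltac:(lra).
    apply: (eventually_leftW _ _ _ _ E) => x _ h.
    have half : 0 < (1 / 2 : R) < 1 by apply/andP; split; lra.
    by have [] := near1_ratio _ _ _ half (neglogtail_ge0 mu x) h.
  apply: cramer_equiv => //.
  have [van|] := pselect (forall c, 0 < c ->
      exists2 x, (x%:E < right_endpoint mu)%E & tail mu x < c).
    exact: (mgf_at_vanishing_tail mu V a axs cV lim van).
  (* The tail now stays above some [c > 0] below the endpoint. This rules out [+oo], and left
     continuity carries the bound to a finite endpoint. *)
  move=> /existsNP[c /not_implyP[c0 nvan]].
  have ct x : (x%:E < right_endpoint mu)%E -> c <= tail mu x.
    by move=> xx; rewrite leNgt; apply/negP => xc; apply: nvan; exists x.
  case xr : (right_endpoint mu) => [r| |].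
  + have ctr : c <= tail mu r.
      rewrite leNgt; apply/negP => /tail_left_continuous[b br].
      by apply/negP; rewrite -leNgt ct// xr lte_fin.
    (* Since [neglogtail] is monotone where the tail is positive, its positivity at some [x < r]
       passes to [r]: [mu] is not the Dirac mass at [r]. *)
    have [x xx Nx] := eventually_left_ex _ _ Npos.
    apply: mgf_at_atom => //; first exact: lt_le_trans ctr.
    apply: (lt_le_trans Nx).
    rewrite -lerN2 -ler_expR !expR_neglogtail ?(lt_le_trans c0)// ?ct//.
    by apply: tail_antitone; rewrite -lee_fin -xr ltW.
  + have [x] := tail_pinfty mu c c0.
    by rewrite ltNge ct// xr ltry.
  + by move: axs; rewrite xr.
Qed.
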